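(* Let $X$ be a Hadamard space and $f:X\to\,]-\infty,+\infty]$ a convex, proper and lower semicontinuous function with $\mathrm{Argmin} f\neq\varnothing$. Let $\{\lambda_k\}$ be a sequence of positive reals with $\liminf_k\lambda_k>0$, let $u,x_1\in X$, and let $\{\alpha_k\}\subset(0,1)$ satisfy $\lim_k\alpha_k=0$ and $\sum_{k=1}^{\infty}\alpha_k=+\infty$. Then the sequence $\{x_k\}$ generated by $$x_{k+1}=\alpha_ku\oplus(1-\alpha_k)J^f_{\lambda_k}x_k\qquad(k\ge1)$$ converges strongly (i.e. in the metric) to $\mathrm{Proj}_{\mathrm{Argmin} f}u$.
   Context: A Hadamard space is a complete CAT(0) space. $(1-t)x\oplus ty$ denotes the unique point $z$ of the geodesic segment $[x,y]$ with $d(x,z)=t\,d(x,y)$ and $d(y,z)=(1-t)d(x,y)$. $\mathrm{Proj}_S u$ is the nearest point of a nonempty closed convex set $S$ to $u$. The domain of $f$ is $D(f)=\{x\in X: f(x)<+\infty\}$; $f$ is proper if $D(f)\neq\varnothing$; convex if $f(tx\oplus(1-t)y)\le tf(x)+(1-t)f(y)$ for all $x,y\in X$, $t\in[0,1]$; lower semicontinuous if, at each point $x\in D(f)$, $\liminf_n f(y_n)\ge f(x)$ for each sequence $y_n\to x$. For $\lambda>0$ the resolvent is $J^f_\lambda x:=\mathrm{Argmin}_{y\in X}\{f(y)+\frac1{2\lambda}d^2(y,x)\}$, whose existence and uniqueness for every $x\in X$ is taken as known. *)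

(* Defs.v *)
From HB Require Import structures.
From mathcomp Require Import all_boot all_order all_algebra.
From mathcomp Require Import all_classical all_reals all_analysis.

Set Implicit Arguments.
Unset Strict Implicit.
Unset Printing Implicit Defensive.

Import Order.TTheory GRing.Theory Num.Theory.
Import numFieldNormedType.Exports.

Local Open Scope classical_set_scope.
Local Open Scope ring_scope.

#[short(type="completeMetricType")]
HB.structure Definition CompleteMetric (R : numDomainType) :=
  {T of Metric R T & Complete T}.

Section cat0.
Context {R : realType}.

(* The library's norm on 'rV[R]_2 is the sup norm, hence this definition. *)
Definition euclid_dist (p q : 'rV[R]_2) : R :=
  Num.sqrt (\sum_(i < 2) (p 0 i - q 0 i) ^+ 2).

Context {X : metricType R}.
Implicit Types (x y z : X) (S : set X).

Definition is_geodesic x y (c : R -> X) : Prop :=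
  [/\ c 0 = x, c (mdist x y) = y &
      {in `[0, mdist x y] &, forall s t, mdist (c s) (c t) = `|s - t|}].

Definition geodesic_segment x y S : Prop :=
  exists2 c, is_geodesic x y c & S = c @` `[0, mdist x y].

(* x' is a comparison point, on the Euclidean segment [p', q'], for a point x
   of a geodesic segment [p, q]. *)
Definition comparison_point (p : X) (p' q' : 'rV[R]_2) x (x' : 'rV[R]_2) :=
  (exists2 t : R, 0 <= t <= 1 & x' = (1 - t) *: p' + t *: q') /\
  euclid_dist p' x' = mdist p x.

(* Triangles are indexed cyclically: side S i joins v i to v (i + 1 mod 3). *)
Definition geodesic_triangle (v : 'I_3 -> X) (S : 'I_3 -> set X) : Prop :=
  forall i, geodesic_segment (v i) (v (ordS i)) (S i).

Definition comparison_triangle (v : 'I_3 -> X) (v' : 'I_3 -> 'rV[R]_2) : Prop :=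
  forall i j, euclid_dist (v' i) (v' j) = mdist (v i) (v j).

End cat0.

Definition geodesic_space {R : realType} (X : metricType R) : Prop :=
  forall x y : X, exists c, is_geodesic x y c.

Definition CAT0 {R : realType} (X : metricType R) : Prop :=
  geodesic_space X /\
  forall (v : 'I_3 -> X) (S : 'I_3 -> set X) (v' : 'I_3 -> 'rV[R]_2),
    geodesic_triangle v S -> comparison_triangle v v' ->
    forall (i j : 'I_3) (x y : X) (x' y' : 'rV[R]_2),
      S i x -> comparison_point (v i) (v' i) (v' (ordS i)) x x' ->
      S j y -> comparison_point (v j) (v' j) (v' (ordS j)) y y' ->
      mdist x y <= euclid_dist x' y'.

Section convex_analysis.
Context {R : realType} {X : metricType R}.
Implicit Types (x y z u : X) (S : set X) (f : X -> \bar R) (t lambda : R).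

(* t x (+) (1 - t) y : the weight t is that of x. The default x is irrelevant
   in a CAT(0) space when 0 <= t <= 1, where such a point exists uniquely. *)
Definition oplus t x y : X :=
  xget x [set z | (exists2 S, geodesic_segment x y S & S z) /\
                  mdist x z = (1 - t) * mdist x y /\
                  mdist y z = t * mdist x y].

Definition edomain f : set X := [set x | (f x < +oo)%E].

Definition eproper f : Prop := edomain f !=set0.

Definition econvex f : Prop :=
  forall x y t, 0 <= t <= 1 ->
    (f (oplus t x y) <= t%:E * f x + (1 - t)%:E * f y)%E.

Definition elsc f : Prop :=
  forall x, edomain f x -> forall y : nat -> X, y @ \oo --> x ->
    (f x <= limn_einf (f \o y))%E.

Definition argmin f : set X := [set x | forall y, (f x <= f y)%E].

Definition resolvent_objective f lambda x : X -> \bar R :=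
  fun y => (f y + ((2 * lambda)^-1 * mdist y x ^+ 2)%:E)%E.

(* Existence and uniqueness of all resolvents. It does not follow from elsc,
   which constrains f only at points of its domain: for the indicator function
   of the interval ]0, 1[ of the real line, no resolvent at 2 exists. *)
Definition resolvents_well_defined f : Prop :=
  forall lambda x, 0 < lambda ->
    exists! z, argmin (resolvent_objective f lambda x) z.

Definition resolvent f lambda x : X :=
  xget x (argmin (resolvent_objective f lambda x)).

Definition metric_proj S u : X :=
  xget u [set z | S z /\ forall w, S w -> mdist u z <= mdist u w].

End convex_analysis.

(* Main.v *)
(* With p the projection of u onto Argmin f, D = d(p, u) and y_k the proximal
   point of x_k, the CAT(0) inequality and strong convexity of the proximal
   objective give, for e_k = f(y_k) - min f,
     d(x_{k+1}, p)^2 <= (1 - alpha_k) (d(x_k, p)^2 - 2 lambda_k e_k)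
                        + alpha_k (D^2 - (1 - alpha_k) d(u, y_k)^2).
   Delta-convergence is avoided by comparing y_k with the resolvent z_m of u of
   parameter m: minimality of z_m gives d(u, y_k)^2 >= d(u, z_m)^2 - 2 m e_k,
   and the error m alpha_k e_k is absorbed by lambda_k e_k once alpha_k is
   small. As m grows, z_m converges to p, so that d(u, z_m)^2 tends to D^2 and
   d(x_{k+1}, p)^2 <= (1 - alpha_k) d(x_k, p)^2 + alpha_k o(1). *)
Require Import Defs.
From mathcomp Require Import all_boot all_order all_algebra.
From mathcomp Require Import all_classical all_reals all_analysis.
From mathcomp Require Import ring lra.

Set Implicit Arguments.
Unset Strict Implicit.
Unset Printing Implicit Defensive.

Import Order.TTheory GRing.Theory Num.Theory.
Import numFieldNormedType.Exports.

Local Open Scope classical_set_scope.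
Local Open Scope ring_scope.

(** * The Euclidean comparison plane *)

Section plane.
Context {R : realType}.
Implicit Types (p q r : 'rV[R]_2).

Lemma sqr_euclid_dist p q :
  euclid_dist p q ^+ 2 = (p 0 0 - q 0 0) ^+ 2 + (p 0 1 - q 0 1) ^+ 2.
Proof.
rewrite /euclid_dist sqr_sqrtr; last by apply: sumr_ge0 => i _; exact: sqr_ge0.
rewrite !big_ord_recl big_ord0 addr0.
by congr (_ + (p 0 _ - q 0 _) ^+ 2); apply/val_inj.
Qed.

Lemma euclid_dist_ge0 p q : 0 <= euclid_dist p q.
Proof. exact: sqrtr_ge0. Qed.

Lemma euclid_distE p q (d : R) : 0 <= d ->
  (p 0 0 - q 0 0) ^+ 2 + (p 0 1 - q 0 1) ^+ 2 = d ^+ 2 -> euclid_dist p q = d.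
Proof.
move=> d0; rewrite -sqr_euclid_dist => /eqP.
by rewrite eqrXn2// ?euclid_dist_ge0// => /eqP.
Qed.

Lemma euclid_dist_sym p q : euclid_dist p q = euclid_dist q p.
Proof.
apply: euclid_distE; rewrite ?euclid_dist_ge0// sqr_euclid_dist; ring.
Qed.

Lemma euclid_distxx p : euclid_dist p p = 0.
Proof. by apply: euclid_distE => //; rewrite !subrr expr0n addr0. Qed.

Lemma euclid_dist_combl p q (s : R) : 0 <= s ->
  euclid_dist p ((1 - s) *: p + s *: q) = s * euclid_dist p q.
Proof.
move=> s0; apply: euclid_distE; first by rewrite mulr_ge0// euclid_dist_ge0.
by rewrite exprMn sqr_euclid_dist !mxE; ring.
Qed.

(** Stewart's theorem, the equality case of the CAT(0) inequality. *)
Lemma sqr_euclid_dist_comb p q r (s : R) :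
  euclid_dist ((1 - s) *: p + s *: q) r ^+ 2 =
  (1 - s) * euclid_dist p r ^+ 2 + s * euclid_dist q r ^+ 2
  - (1 - s) * s * euclid_dist p q ^+ 2.
Proof. by rewrite !sqr_euclid_dist !mxE; ring. Qed.

(** With [p] at the origin and [q] on the first axis, the law of cosines gives the abscissa [s] of
    [r]; Heron's factorization makes the squared height nonnegative. *)
Lemma euclid_triangle_exists (a b c : R) : 0 <= a -> 0 <= b -> 0 <= c ->
  a <= c + b -> b <= a + c -> c <= a + b ->
  exists p q r, [/\ euclid_dist p q = a, euclid_dist q r = b &
                    euclid_dist p r = c].
Proof.
move=> a0 b0 c0 ab bc ca.
(* when a = 0, division by zero puts r at (0, c), which is correct *)
pose s := (a ^+ 2 + c ^+ 2 - b ^+ 2) / (2 * a).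
have sE : 2 * a * s = a ^+ 2 + c ^+ 2 - b ^+ 2.
  have [a00|aN0] := eqVneq a 0; last by rewrite /s; field.
  have -> : b = c by lra.
  by rewrite a00; ring.
have s2 : 0 <= c ^+ 2 - s ^+ 2.
  have [a00|aN0] := eqVneq a 0.
    by rewrite /s a00 mulr0 invr0 mulr0 expr0n subr0 sqr_ge0.
  have a2 : 0 < 4 * a ^+ 2.
    by rewrite mulr_gt0// exprn_gt0// lt_neqAle eq_sym aN0.
  rewrite -(pmulr_rge0 _ a2).
  have -> : 4 * a ^+ 2 * (c ^+ 2 - s ^+ 2) =
      (2 * a * c) ^+ 2 - (2 * a * s) ^+ 2 by ring.
  rewrite sE.
  have -> : (2 * a * c) ^+ 2 - (a ^+ 2 + c ^+ 2 - b ^+ 2) ^+ 2 =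
      ((b - a + c) * (b + a - c)) * ((a + c - b) * (a + c + b)) by ring.
  by rewrite !mulr_ge0//; lra.
pose mk (x y : R) : 'rV[R]_2 := \row_i (if i == 0 then x else y).
have mk0 x y : mk x y 0 0 = x by rewrite mxE.
have mk1 x y : mk x y 0 1 = y by rewrite mxE.
exists (mk 0 0), (mk a 0), (mk s (Num.sqrt (c ^+ 2 - s ^+ 2))).
split; apply: euclid_distE => //; rewrite !mk0 !mk1 ?sub0r ?sqrrN ?sqr_sqrtr//.
- by rewrite expr0n addr0.
- have -> : (a - s) ^+ 2 + (c ^+ 2 - s ^+ 2) = a ^+ 2 + c ^+ 2 - 2 * a * s.
    by ring.
  by rewrite sE; ring.
- by ring.
Qed.

End plane.

(** * From comparison triangles to the CAT(0) inequality *)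

Section cat0_inequality.
Context {R : realType} {X : metricType R}.
Implicit Types (x y z w : X) (t : R).

Lemma geodesic_oplus_spec x y (c : R -> X) t :
  is_geodesic x y c -> 0 <= t <= 1 ->
  let z := c ((1 - t) * mdist x y) in
  [/\ (c @` `[0, mdist x y]) z, mdist x z = (1 - t) * mdist x y &
      mdist y z = t * mdist x y].
Proof.
move=> [c0 c1 cd] /andP[t0 t1] z; have d0 := mdist_ge0 x y.
have td : 0 <= t * mdist x y by rewrite mulr_ge0.
have td' : 0 <= (1 - t) * mdist x y by rewrite mulr_ge0// subr_ge0.
have in0 : 0 \in `[0, mdist x y] by rewrite in_itv/= lexx.
have ind : mdist x y \in `[0, mdist x y] by rewrite in_itv/= lexx andbT.
have inz : (1 - t) * mdist x y \in `[0, mdist x y] by rewrite in_itv/=; lra.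
split; first by exists ((1 - t) * mdist x y).
- by rewrite -[X in mdist X _ = _]c0 cd// sub0r normrN ger0_norm.
- by rewrite -[X in mdist X _ = _]c1 cd// ger0_norm; lra.
Qed.

Lemma oplusP x y t : geodesic_space X -> 0 <= t <= 1 ->
  (exists2 S, geodesic_segment x y S & S (oplus t x y)) /\
  mdist x (oplus t x y) = (1 - t) * mdist x y /\
  mdist y (oplus t x y) = t * mdist x y.
Proof.
move=> hX t01; have [c cg] := hX x y.
have [h1 h2 h3] := geodesic_oplus_spec cg t01.
apply: (@xgetPex _ x [set z | (exists2 S, geodesic_segment x y S & S z) /\
                  mdist x z = (1 - t) * mdist x y /\
                  mdist y z = t * mdist x y]).
exists (c ((1 - t) * mdist x y)); split => //.
by exists (c @` `[0, mdist x y]) => //; exists c.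
Qed.

(** In the comparison triangle of [x], [y], [w] the right-hand side is exact by Stewart's theorem;
    comparison with the vertex [w] transfers it to [X]. *)
Lemma CAT0_sqr_mdist_oplus x y w t : CAT0 X -> 0 <= t <= 1 ->
  mdist (oplus t x y) w ^+ 2 <=
  t * mdist x w ^+ 2 + (1 - t) * mdist y w ^+ 2 - t * (1 - t) * mdist x y ^+ 2.
Proof.
move=> [geoX cmp] t01; have /andP[t0 t1] := t01.
have [[S0 S0g S0z] [xz yz]] := oplusP x y geoX t01.
set z := oplus t x y in S0z xz yz *.
have [c1 c1g] := geoX y w; have [c2 c2g] := geoX w x.
have [|||p [q [r [pq qr pr]]]] := @euclid_triangle_exists R _ _ _
  (mdist_ge0 x y) (mdist_ge0 y w) (mdist_ge0 x w).
- by rewrite (metric_sym y w) metric_triangle.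
- by rewrite (metric_sym x y) metric_triangle.
- exact: metric_triangle.
pose v (i : 'I_3) := nth x [:: x; y; w] i.
pose S (i : 'I_3) :=
  nth set0 [:: S0; c1 @` `[0, mdist y w]; c2 @` `[0, mdist w x]] i.
pose v' (i : 'I_3) := nth p [:: p; q; r] i.
have vS : geodesic_triangle v S.
  by case=> [[|[|[|//]]] ?]; [|exists c1|exists c2].
have vv' : comparison_triangle v v'.
  case=> [[|[|[|//]]] ?] [[|[|[|//]]] ?];
    rewrite /v /v' /= ?mdistxx ?euclid_distxx//;
    by rewrite euclid_dist_sym metric_sym.
(* The weight [t] is that of [x], so the parameter counted from [p] is [1 - t]. *)
pose z' := (1 - (1 - t)) *: p + (1 - t) *: q.
have t01' : 0 <= 1 - t <= 1 by lra.
have zz' : comparison_point x p q z z'.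
  split; first by exists (1 - t).
  by rewrite euclid_dist_combl ?pq ?xz//; lra.
(* The vertex [w] is the initial point of the side from [w] to [x]. *)
have wr : comparison_point w r p w r.
  split; last by rewrite mdistxx euclid_distxx.
  by exists 0; rewrite ?lexx ?ler01// subr0 scale1r scale0r addr0.
have S2w : (c2 @` `[0, mdist w x]) w.
  case: c2g => c20 _ _; exists 0 => //=.
  by rewrite in_itv/= lexx mdist_ge0.
have le_zw := cmp v S v' vS vv' (@Ordinal 3 0 isT) (@Ordinal 3 2 isT) z w z' r
  S0z zz' S2w wr.
have : mdist z w ^+ 2 <= euclid_dist z' r ^+ 2.
  by rewrite lerXn2r// nnegrE ?mdist_ge0 ?euclid_dist_ge0.
by rewrite sqr_euclid_dist_comb pq qr pr subKr.
Qed.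

End cat0_inequality.

(** * Resolvents of a convex function and the one-step estimate *)

Section resolvents.
Context {R : realType} {X : metricType R}.
Variable f : X -> \bar R.
Hypotheses (hX : CAT0 X) (f_gtNy : forall y, (-oo < f y)%E)
  (f_convex : econvex f) (f_resolvents : resolvents_well_defined f)
  (f_proper : eproper f).
Implicit Types (x y z w : X) (l : R).

Lemma fineK_edomain y : edomain f y -> (fine (f y))%:E = f y.
Proof. by move=> fy; rewrite fineK// fin_numE -ltNye -ltey f_gtNy. Qed.

Lemma argmin_resolvent l x : 0 < l ->
  argmin (resolvent_objective f l x) (resolvent f l x).
Proof.
move=> l0; apply: (@xgetPex _ x (argmin _)).
by have [z [zP _]] := f_resolvents x l0; exists z.
Qed.

Lemma edomain_resolvent l x : 0 < l -> edomain f (resolvent f l x).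
Proof.
move=> l0; have [y fy] := f_proper.
have := argmin_resolvent x l0 y; rewrite /resolvent_objective/edomain/=.
rewrite -(fineK_edomain fy) -EFinD => /le_lt_trans /(_ (ltry _)).
case: (f (resolvent f l x)) => [r _||_]; [exact: ltry|by []|by rewrite ltNye].
Qed.

Lemma le0_of_perturb (A B : R) :
  (forall t, 0 < t < 1 -> A + (1 - t) * B <= 0) -> A + B <= 0.
Proof.
move=> h; apply/ler_addgt0Pr => e e0; rewrite add0r.
have [B0|B0] := leP B 0.
  have := h (2^-1); lra.
have s0 : 0 < e + B + 1 by lra.
(* This choice of [t] gives [t * B <= e]. *)
have t01 : 0 < e / (e + B + 1) < 1.
  by rewrite divr_gt0//= ltr_pdivrMr//; lra.
have := h _ t01.
have : e / (e + B + 1) * B <= e by rewrite -mulrAC ler_pdivrMr//; nra.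
lra.
Qed.

(** Strong convexity of the proximal objective: its minimizer is compared with the point of weight
    [t] at [y] on the segment to [y]; dividing by [t] and letting [t] tend to 0 leaves the full
    squared distance to [y]. *)
Lemma resolvent_le l x y : 0 < l -> edomain f y ->
  2 * l * (fine (f (resolvent f l x)) - fine (f y))
    + mdist (resolvent f l x) x ^+ 2 + mdist (resolvent f l x) y ^+ 2
  <= mdist y x ^+ 2.
Proof.
move=> l0 fy; have fz := edomain_resolvent x l0.
have zmin := argmin_resolvent x l0.
set z := resolvent f l x in fz zmin *.
rewrite -subr_le0 addrAC; apply: le0_of_perturb => t /andP[t0 t1].
have t01 : 0 <= 1 - t <= 1 by lra.
have cw := f_convex z y t01; have dw := CAT0_sqr_mdist_oplus z y x hX t01.
have zw := zmin (oplus (1 - t) z y); rewrite /resolvent_objective in zw.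
set w := oplus _ _ _ in cw dw zw.
rewrite -(fineK_edomain fy) -(fineK_edomain fz) -!EFinM -EFinD in cw.
have fw : edomain f w by apply: le_lt_trans cw (ltry _).
rewrite -(fineK_edomain fw) lee_fin in cw.
rewrite -(fineK_edomain fw) -(fineK_edomain fz) -!EFinD lee_fin in zw.
have l2 : 0 < 2 * l by rewrite mulr_gt0.
rewrite -(ler_pM2l l2) in cw.
rewrite -(ler_pM2l l2) !mulrDr !mulVKf ?gt_eqF// in zw.
by rewrite -(pmulr_rle0 _ t0); lra.
Qed.

Lemma edomain_argmin p : argmin f p -> edomain f p.
Proof. by have [y fy] := f_proper => /(_ y) /le_lt_trans; exact. Qed.

Lemma fine_argmin_le p y : argmin f p -> edomain f y ->
  fine (f p) <= fine (f y).
Proof.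
move=> fp fy; rewrite -lee_fin !fineK_edomain//; exact: edomain_argmin.
Qed.

(** Testing each resolvent against the other and adding shows that [f] does not increase with the
    parameter. The extra square later yields the Cauchy property. *)
Lemma resolvent_monotone l l' x : 0 < l -> l <= l' ->
  mdist (resolvent f l x) x ^+ 2
    + mdist (resolvent f l x) (resolvent f l' x) ^+ 2
  <= mdist (resolvent f l' x) x ^+ 2.
Proof.
move=> l0; rewrite le_eqVlt => /predU1P[<-|ll'].
  by rewrite mdistxx expr0n addr0.
have l'0 := lt_trans l0 ll'.
have h := resolvent_le x l0 (edomain_resolvent x l'0).
have := resolvent_le x l'0 (edomain_resolvent x l0).
rewrite [mdist (resolvent f l' x) (resolvent f l x)]metric_sym => h'.
set a := fine _ in h h'; set b := fine _ in h h'.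
have E0 := sqr_ge0 (mdist (resolvent f l x) (resolvent f l' x)).
have ab : 0 <= a - b.
  by rewrite -(@pmulr_rge0 _ (l' - l)) ?subr_gt0//; lra.
have : 0 <= 2 * l * (a - b) by rewrite !mulr_ge0// ltW.
lra.
Qed.

(* Lower semicontinuity is only assumed on the domain of f, so a limit of a
   minimizing sequence is shown to be its own resolvent instead. *)
Lemma cvg_minimizing_argmin (y : nat -> X) p q : argmin f p ->
  (forall n, edomain f (y n)) -> y @ \oo --> q ->
  (fun n => fine (f (y n))) @ \oo --> fine (f p) -> argmin f q.
Proof.
move=> fp fy yq fyp; have l0 := @ltr01 R.
have r_dom := edomain_resolvent q l0.
(* Limit of [resolvent_le] along [y]. Both terms are nonnegative, hence zero. *)
have key : 2 * (fine (f (resolvent f 1 q)) - fine (f p))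
    + mdist (resolvent f 1 q) q ^+ 2 <= 0.
  apply/ler_addgt0Pr => e e0; rewrite add0r.
  have e4 : 0 < e / 4 by rewrite divr_gt0.
  (* The bound 1 lets the squared distance inherit the bound [e / 4]. *)
  have d0 : 0 < Num.min 1 (e / 4) by rewrite lt_min ltr01.
  near \oo => n.
  have h := resolvent_le q l0 (fy n).
  have yn : mdist q (y n) <= Num.min 1 (e / 4).
    near: n; exact: metricType_numDomainType.cvgr_dist_le.
  have fn : `|fine (f p) - fine (f (y n))| <= e / 4.
    by near: n; exact: cvgr_dist_le.
  have : mdist (y n) q ^+ 2 <= e / 4.
    move: yn; rewrite le_min metric_sym => /andP[y1 ye].
    by apply: le_trans ye; rewrite expr2 ler_piMl// mdist_ge0.
  move: fn; rewrite ler_norml => /andP[fn1 fn2].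
  have := sqr_ge0 (mdist (resolvent f 1 q) (y n)).
  lra.
have fr := fine_argmin_le fp r_dom.
have rq : resolvent f 1 q = q.
  apply: mdist_positivity; apply/eqP.
  by rewrite -sqrf_eq0 eq_le sqr_ge0 andbT; lra.
have {}key : fine (f q) <= fine (f p).
  by move: key; rewrite rq mdistxx; lra.
rewrite rq in r_dom.
move=> w; apply: le_trans (fp w).
by rewrite -(fineK_edomain r_dom) -(fineK_edomain (edomain_argmin fp)) lee_fin.
Unshelve. all: by end_near. Qed.

(** The two errors vanish separately: the first as [t] tends to 0, the second as [m] grows. *)
Lemma halpern_proximal_step l m t x u p : 0 < l -> 0 < m -> 0 <= t <= 1 ->
  m * t <= l -> argmin f p ->
  mdist (oplus t u (resolvent f l x)) p ^+ 2 <=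
  (1 - t) * mdist x p ^+ 2
  + t * (t * mdist p u ^+ 2
         + (1 - t) * (mdist p u ^+ 2 - mdist (resolvent f m u) u ^+ 2)).
Proof.
move=> l0 m0 t01 mtl fp; have /andP[t0 t1] := t01.
have fpd := edomain_argmin fp.
have fy := edomain_resolvent x l0.
have fz := edomain_resolvent u m0.
have hw := CAT0_sqr_mdist_oplus u (resolvent f l x) p hX t01.
have hy := resolvent_le x l0 fpd.
have hz := resolvent_le u m0 fy.
have pz := fine_argmin_le fp fz; have py := fine_argmin_le fp fy.
rewrite (metric_sym p x) in hy; rewrite (metric_sym p u).
rewrite (metric_sym (resolvent f l x) u) in hz.
set y := resolvent f l x in hw hy hz py fy *.
set z := resolvent f m u in hz pz fz *.
have xy0 := sqr_ge0 (mdist y x); have zy0 := sqr_ge0 (mdist z y).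
set E := fine (f y) - fine (f p).
have E0 : 0 <= E by rewrite subr_ge0.
have hy' : mdist y p ^+ 2 <= mdist x p ^+ 2 - 2 * l * E.
  by rewrite /E; lra.
(* The value of [f] at [z] is bounded below by the minimum. *)
have hz' : mdist z u ^+ 2 - 2 * m * E <= mdist u y ^+ 2.
  have : 0 <= m * (fine (f z) - fine (f p)).
    by rewrite mulr_ge0 ?(ltW m0)// subr_ge0.
  by rewrite /E; lra.
have t10 : 0 <= 1 - t by rewrite subr_ge0.
have h1 := ler_wpM2l t10 hy'.
have h2 := ler_wpM2l (mulr_ge0 t0 t10) hz'.
(* Here [m * t <= l] absorbs the error in [E]. *)
have : 0 <= (1 - t) * ((l - m * t) * E) by rewrite !mulr_ge0// subr_ge0.
lra.
Qed.

End resolvents.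

(** * Resolvents at a fixed point as the parameter grows *)

Lemma cauchy_cvg_mdist (R : realType) (X : completeMetricType R)
    (y : nat -> X) :
  (forall e, 0 < e -> exists N, forall n, (N <= n)%N ->
    mdist (y N) (y n) < e) ->
  exists q : X, y @ \oo --> q.
Proof.
move=> h; exists (lim (y @ \oo)); apply: cauchy_cvg; apply: cauchy_exP => e e0.
have [N hN] := h e e0; exists (y N); exists N => // n /= /hN.
by rewrite ballEmdist.
Qed.

Section regularization.
Context {R : realType} {X : completeMetricType R}.
Variable f : X -> \bar R.
Hypotheses (hX : CAT0 X) (f_gtNy : forall y, (-oo < f y)%E)
  (f_convex : econvex f) (f_resolvents : resolvents_well_defined f)
  (f_proper : eproper f).

(* The resolvents at u of parameters n.+1 form a Cauchy sequence, their
   distances to u being nondecreasing and bounded by the distance from u to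
   any minimizer; their limit is the projection of u. *)
Lemma cvg_resolvent_metric_proj (u : X) : argmin f !=set0 ->
  argmin f (metric_proj (argmin f) u) /\
  (fun n => mdist (resolvent f n.+1%:R u) u) @ \oo
    --> mdist (metric_proj (argmin f) u) u.
Proof.
move=> [p0 fp0]; set z := fun n => resolvent f n.+1%:R u.
pose a n := mdist (z n) u ^+ 2.
have n0 n : 0 < n.+1%:R :> R by [].
have f_z n : edomain f (z n) by exact: edomain_resolvent.
have a_mono n k : (n <= k)%N -> a n + mdist (z n) (z k) ^+ 2 <= a k.
  by move=> nk; apply: resolvent_monotone => //; rewrite ler_nat.
have zp p n : argmin f p ->
    2 * n.+1%:R * (fine (f (z n)) - fine (f p)) + a n <= mdist p u ^+ 2.
  move=> fp; have fpd := edomain_argmin f_proper fp.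
  have := resolvent_le hX f_gtNy f_convex f_resolvents f_proper u (n0 n) fpd.
  rewrite -/(z n) -/(a n); have := sqr_ge0 (mdist (z n) p); lra.
have fpz p n : argmin f p -> fine (f p) <= fine (f (z n)).
  by move=> fp; apply: fine_argmin_le.
have a_le p n : argmin f p -> a n <= mdist p u ^+ 2.
  move=> fp; apply: le_trans (zp p n fp); rewrite lerDr !mulr_ge0//.
  by rewrite subr_ge0 fpz.
have d_le p n : argmin f p -> mdist (z n) u <= mdist p u.
  by move=> fp; rewrite -(@ler_pXn2r _ 2) ?nnegrE ?mdist_ge0//; exact: a_le.
have cvg_a : a @ \oo --> sup (range a).
  apply: nondecreasing_cvgn.
    move=> n k nk; apply: le_trans (a_mono n k nk).
    by rewrite lerDl sqr_ge0.
  by exists (mdist p0 u ^+ 2) => _ [n _ <-]; exact: a_le.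
have a_sup n : a n <= sup (range a).
  apply: ub_le_sup; last by exists n.
  by exists (mdist p0 u ^+ 2) => _ [k _ <-]; exact: a_le.
have [q zq] : exists q : X, z @ \oo --> q.
  apply: cauchy_cvg_mdist => e e0.
  (* By [a_mono], squared distances are bounded by increments of the convergent sequence [a]. *)
  have e20 : 0 < e ^+ 2 by rewrite exprn_gt0.
  have /cvgrPdist_lt /(_ _ e20) [N _ hN] := cvg_a.
  exists N => n Nn; rewrite -(@ltr_pXn2r _ 2) ?nnegrE ?mdist_ge0 ?(ltW e0)//.
  have := hN N (leqnn N); rewrite ger0_norm ?subr_ge0//.
  by have := a_mono _ _ Nn; have := a_sup n; lra.
have fq : argmin f q.
  apply: (cvg_minimizing_argmin hX f_gtNy f_convex f_resolvents f_proper
    fp0 f_z zq).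
  apply: (@squeeze_cvgr _ _ _ _ (cst (fine (f p0)))
    (fun n => fine (f p0) + mdist p0 u ^+ 2 * n.+1%:R^-1)).
  - apply: nearW => n; rewrite /cst fpz//= -lerBlDl ler_pdivlMr//.
    have := zp _ n fp0; have : 0 <= a n by exact: sqr_ge0.
    have : 0 <= n.+1%:R * (fine (f (z n)) - fine (f p0)).
      by rewrite mulr_ge0// subr_ge0 fpz.
    lra.
  - exact: cvg_cst.
  - rewrite -[X in _ --> X]addr0 -[X in _ + X](mulr0 (mdist p0 u ^+ 2)).
    by apply: cvgD; [exact: cvg_cst|apply: cvgMr; exact: cvg_harmonic].
(* The upper bound is [d_le] at [q] itself; the lower one is the triangle inequality. *)
have dq : (fun n => mdist (z n) u) @ \oo --> mdist q u.
  apply/cvgrPdist_le => e e0.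
  near=> n.
  have : mdist q (z n) <= e.
    by near: n; exact: metricType_numDomainType.cvgr_dist_le.
  have := d_le q n fq; have := metric_triangle q (z n) u.
  rewrite ler_norml; lra.
have q_proj w : argmin f w -> mdist u q <= mdist u w.
  move=> fw; rewrite ![mdist u _]metric_sym.
  rewrite -(cvg_lim _ dq)//; apply: limr_le.
    by apply/cvg_ex; exists (mdist q u).
  by apply: nearW => n; exact: d_le.
(* Since [q] is a nearest minimizer, [metric_proj] does not take its default value; both points are
   nearest to [u], hence equally distant from it. *)
have [fP P_proj] : argmin f (metric_proj (argmin f) u) /\
    forall w, argmin f w -> mdist u (metric_proj (argmin f) u) <= mdist u w.
  apply: (@xgetPex _ u [set z | argmin f z /\
    forall w, argmin f w -> mdist u z <= mdist u w]).
  by exists q.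
split => //; suff -> : mdist (metric_proj (argmin f) u) u = mdist q u by [].
by rewrite ![mdist _ u]metric_sym; apply/eqP; rewrite eq_le P_proj// q_proj.
Unshelve. all: by end_near. Qed.

End regularization.

(** * Recursive inequalities and divergent series of reals *)

(* The product of the factors 1 - alpha k is at most the inverse of
   1 + \sum alpha k. *)
Lemma halpern_recursion (R : realType) (a alpha : nat -> R) (e : R) (N : nat) :
  (forall k, (N <= k)%N -> 0 <= alpha k <= 1) ->
  (forall k, (N <= k)%N -> a k.+1 <= (1 - alpha k) * a k + alpha k * e) ->
  (fun n => \sum_(N <= k < n) alpha k) @ \oo --> +oo ->
  forall d, 0 < d -> \forall n \near \oo, a n <= e + d.
Proof.
move=> alpha01 arec sumoo d d0.
pose s n := \sum_(N <= k < n) alpha k.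
pose B := Num.max (a N - e) 0.
have s_ge0 n : 0 <= s n.
  by rewrite /s big_nat_cond sumr_ge0// => k /andP[/andP[/alpha01/andP[]]].
have bound n : (N <= n)%N -> (a n - e) * (1 + s n) <= B.
  elim: n => [|n IHn].
    rewrite leqn0 => /eqP N0.
    by rewrite /s N0 big_geq// addr0 mulr1 /B N0 le_max lexx.
  rewrite leq_eqVlt => /predU1P[<-|].
    by rewrite /s big_geq// addr0 mulr1 le_max lexx.
  rewrite ltnS => Nn; have {IHn} := IHn Nn.
  have -> : s n.+1 = s n + alpha n by rewrite /s big_nat_recr.
  have := arec n Nn; have /andP[al0 al1] := alpha01 n Nn; have := s_ge0 n.
  move: (s n) (a n) (a n.+1) (alpha n) al0 al1 => S A A' t t0 t1 S0 A'A IH.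
  have h : A' - e <= (1 - t) * (A - e) by lra.
  have St : 0 <= 1 + (S + t) by lra.
  apply: le_trans (ler_wpM2r St h) _.
  (* A nonpositive excess is covered by [0 <= B]; otherwise [(1 - t) * (1 + S + t) <= 1 + S]
     propagates the bound. *)
  have [Ae|Ae] := leP (A - e) 0.
    apply: (@le_trans _ _ 0); last by rewrite le_max lexx orbT.
    by rewrite mulr_le0_ge0// mulr_ge0_le0// subr_ge0.
  apply: le_trans IH; rewrite mulrAC mulrC ler_pM2l//.
  have : 0 <= t * S by rewrite mulr_ge0.
  have := sqr_ge0 t; lra.
have /cvgryPge /(_ (B / d)) [M _ hM] := sumoo.
near=> n.
have Nn : (N <= n)%N by near: n; exact: nbhs_infty_ge.
have : B / d <= s n by apply: hM; near: n; exact: nbhs_infty_ge.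
rewrite ler_pdivrMr// => hB.
rewrite -lerBlDl; have s1 : 0 < 1 + s n by have := s_ge0 n; lra.
rewrite -(ler_pM2r s1); apply: le_trans (bound n Nn) _; lra.
Unshelve. all: by end_near. Qed.

(** The lower limit is the supremum of the tail infima, so one of these is positive; it is finite
    because a term bounds it above, and serves as [c]. *)
Lemma limn_einf_gt0 (R : realType) (v : nat -> R) :
  (0 < limn_einf (fun k => (v k)%:E))%E ->
  exists2 c, 0 < c & \forall k \near \oo, c <= v k.
Proof.
rewrite limn_einf_lim (cvg_lim _ (@cvg_einfs_sup _ _))//.
move=> /ereal_sup_gt[_ [N _ <-]] vN.
have v_ge k : (N <= k)%N -> (einfs (fun k => (v k)%:E) N <= (v k)%:E)%E.
  by move=> Nk; apply: ereal_inf_lbound; exists k.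
move: vN v_ge; case: (einfs _ N) => [c| _ /(_ N (leqnn N))|].
- by rewrite lte_fin => c0 h; exists c => //; exists N => // k /h;
    rewrite lee_fin.
- by rewrite leye_eq.
- by rewrite ltNge leNye.
Qed.

Lemma cvg_partial_sums_pinfty (R : realType) (v : nat -> R) (m N : nat) :
  (m <= N)%N -> (forall k, (m <= k)%N -> 0 <= v k) ->
  (\sum_(m <= k <oo) (v k)%:E = +oo)%E ->
  (fun n => \sum_(N <= k < n) v k) @ \oo --> +oo.
Proof.
move=> mN v0 voo; have cv : cvgn (fun n => \sum_(m <= k < n) (v k)%:E)%E.
  by apply: is_cvg_nneseries => k mk _; rewrite lee_fin v0.
have {cv voo} cv : ((\sum_(m <= k < n) (v k)%:E)%E @[n --> \oo] --> +oo%E).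
  by rewrite -voo.
apply/cvgryPge => A; have := cvgey_ge cv (\sum_(m <= k < N) v k + A).
move=> h; near=> n.
have Nn : (N <= n)%N by near: n; exact: nbhs_infty_ge.
have : ((\sum_(m <= k < N) v k + A)%:E <= \sum_(m <= k < n) (v k)%:E)%E.
  by near: n; exact: h.
by rewrite sumEFin lee_fin (big_cat_nat mN Nn)/= lerD2l.
Unshelve. all: by end_near. Qed.

(** * Convergence of the proximal Halpern iteration *)

Theorem theorem3p12 (R : realType) (X : completeMetricType R)
    (f : X -> \bar R) (lambda alpha : nat -> R) (u : X) (x : nat -> X)
    (hX : CAT0 X)
    (f_gtNy : forall y, (-oo < f y)%E)
    (f_convex : econvex f) (f_proper : eproper f) (f_lsc : elsc f)
    (f_resolvents : resolvents_well_defined f)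
    (f_argmin : argmin f !=set0)
    (lambda_gt0 : forall k, (1 <= k)%N -> 0 < lambda k)
    (lambda_liminf : (0 < limn_einf (fun k => (lambda k)%:E))%E)
    (alpha01 : forall k, (1 <= k)%N -> 0 < alpha k < 1)
    (alpha_cvg0 : alpha @ \oo --> 0)
    (alpha_sum : (\sum_(1 <= k <oo) (alpha k)%:E = +oo)%E)
    (x_iter : forall k, (1 <= k)%N ->
      x k.+1 = oplus (alpha k) u (resolvent f (lambda k) (x k))) :
  x @ \oo --> metric_proj (argmin f) u.
Proof.
have [fP dP] := cvg_resolvent_metric_proj hX f_gtNy f_convex f_resolvents
  f_proper u f_argmin.
set p := metric_proj _ _ in fP dP *.
have [c c0 lambda_ge] := limn_einf_gt0 lambda_liminf.
have alpha_ge0 k : (1 <= k)%N -> 0 <= alpha k by move=> /alpha01/andP[/ltW].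
apply/metricType_numDomainType.cvgrPdist_le => d d0.
pose e := d ^+ 2; have e0 : 0 < e by rewrite exprn_gt0.
have e4 : 0 < e / 4 by rewrite divr_gt0.
have [n hn] : exists n,
    mdist p u ^+ 2 - mdist (resolvent f n.+1%:R u) u ^+ 2 <= e / 4.
  have dP2 : (fun n => mdist (resolvent f n.+1%:R u) u ^+ 2) @ \oo
      --> mdist p u ^+ 2 by exact: cvgM.
  move/cvgrPdist_le : dP2 => /(_ _ e4) [n _ /(_ n (leqnn n))] /=.
  by move=> /(le_trans (ler_norm _)) h; exists n.
have n0 : 0 < n.+1%:R :> R by [].
have b0 : 0 < mdist p u ^+ 2 + 1 by have := sqr_ge0 (mdist p u); lra.
(* The first bound gives [m * alpha k <= lambda k] with [m = n.+1], the second makes the error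
   [alpha k * mdist p u ^+ 2] at most [e / 4]; the added 1 keeps the divisor positive when
   [u = p]. *)
pose b := Num.min (c / n.+1%:R) (e / 4 / (mdist p u ^+ 2 + 1)).
have b_gt0 : 0 < b by rewrite lt_min !divr_gt0.
have [N _ hN] : \forall k \near \oo,
    [/\ (1 <= k)%N, c <= lambda k & alpha k <= b].
  near=> k; split.
  - by near: k; exact: nbhs_infty_ge.
  - by near: k; exact: lambda_ge.
  - have : `|0 - alpha k| <= b by near: k; exact: cvgr_dist_le.
    by rewrite sub0r normrN; apply: le_trans; exact: ler_norm.
(* Two errors of [e / 4] add up to [e / 2]. Starting at [N.+1] keeps all indices at least 1. *)
have step k : (N.+1 <= k)%N -> mdist (x k.+1) p ^+ 2 <=
    (1 - alpha k) * mdist (x k) p ^+ 2 + alpha k * (e / 2).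
  move=> Nk; have [k1 ck] := hN k (ltnW Nk); rewrite le_min => /andP[].
  rewrite !ler_pdivlMr// => ac ab.
  have a01 : 0 <= alpha k <= 1 by have := alpha01 k k1; lra.
  have mt : n.+1%:R * alpha k <= lambda k by rewrite mulrC (le_trans ac).
  have := halpern_proximal_step hX f_gtNy f_convex f_resolvents f_proper
    (x k) u (lambda_gt0 k k1) n0 a01 mt fP.
  rewrite -x_iter// => /le_trans; apply.
  rewrite lerD2l ler_wpM2l ?alpha_ge0//.
  have : (1 - alpha k) * (mdist p u ^+ 2 - mdist (resolvent f n.+1%:R u) u ^+ 2)
      <= (1 - alpha k) * (e / 4) by rewrite ler_wpM2l//; lra.
  have : 0 <= alpha k * (e / 4) by rewrite mulr_ge0 ?alpha_ge0 ?ltW.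
  have := alpha_ge0 k k1; lra.
have sumN := cvg_partial_sums_pinfty (ltn0Sn N) alpha_ge0 alpha_sum.
have alphaN k : (N.+1 <= k)%N -> 0 <= alpha k <= 1.
  by move=> Nk; have := alpha01 k (leq_trans (ltn0Sn N) Nk); lra.
have e2 : 0 < e / 2 by rewrite divr_gt0.
have h := halpern_recursion alphaN step sumN e2.
near=> k.
rewrite metric_sym -(@ler_pXn2r _ 2) ?nnegrE ?mdist_ge0 ?(ltW d0)//.
by rewrite -/e [e]splitr; near: k; exact: h.
Unshelve. all: by end_near. Qed.
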